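(* Let $n\ge 2$ and suppose the players' values satisfy $v_1 = v_2 = \cdots = v_{n-1} > v_n > 0$. Then: 1. Among all formats for $n$ players, the format that has exactly one match in each round results in the highest value of $P_n$. 2. If $n = 2^s + k$ with integers $s\ge 0$ and $1\le k\le 2^s$, then the format that schedules $k$ matches in round $1$ and then has all remaining players competing in each subsequent round minimizes $P_n$ among all formats for $n$ players.
   Context: Random knockout tournament: there are $n\ge 2$ players $1,\dots,n$ with positive values $v_1,\dots,v_n$. A format is a tuple $(r,m_1,\dots,m_r)$ of positive integers with $\sum_{s=1}^r m_s = n-1$ and $2m_s \le r_s$ for each $s$, where $r_s = n-\sum_{j=1}^{s-1} m_j$ is the number of players still alive (not eliminated) at the start of round $s$. In round $s$, independently of the past given the set of alive players, $2m_s$ of the $r_s$ alive players are chosen uniformly at random and are uniformly randomly arranged into $m_s$ match pairs. A match between $i$ and $j$ is won by $i$ with probability $v_i/(v_i+v_j)$, independently of everything else. Losers are eliminated; the winners and the alive players not chosen to play advance to the next round. After round $r$ exactly one player remains, the winner of the tournament. $P_i$ denotes the probability that player $i$ wins the tournament (it depends on the format). The format in part 2 has match numbers $k,2^{s-1},2^{s-2},\dots,1$. *)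

(* Defs.v *)
From HB Require Import structures.
From mathcomp Require Import all_boot all_order all_algebra.

Set Implicit Arguments.
Unset Strict Implicit.
Unset Printing Implicit Defensive.

Import Order.TTheory GRing.Theory Num.Theory.
Local Open Scope ring_scope.

(* Rounds are numbered from 0, so that [n - sumn (take s ms)] players are alive
   at the start of round [s]. *)
Definition is_format (n : nat) (ms : seq nat) : Prop :=
  [/\ (0 < size ms)%N,
      all (fun m => (0 < m)%N) ms,
      sumn ms = (n - 1)%N &
      forall s, (s < size ms)%N ->
        (2 * nth 0%N ms s <= n - sumn (take s ms))%N].

Definition single_match_format (n : nat) : seq nat := nseq (n - 1) 1%N.

(* k, 2^(s-1), 2^(s-2), ..., 1 *)
Definition halving_format (s k : nat) : seq nat :=
  k :: [seq (2 ^ (s - i.+1))%N | i <- iota 0 s].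

Section Tournament.
Variables (R : realFieldType) (n : nat).
Implicit Types (v : 'I_n -> R) (A B S : {set 'I_n}).

(* The expectation of [f] under the uniform distribution on [E]. *)
Definition uniform_mean (T : finType) (E : {set T}) (f : T -> R) : R :=
  (\sum_(x in E) f x) / #|E|%:R.

Definition selections (m : nat) (A : {set 'I_n}) : {set {set 'I_n}} :=
  [set S : {set 'I_n} | (S \subset A) && (#|S| == 2 * m)%N].

(* An arrangement [g] of the players of [S] into [m] match pairs: match [k] is
   between [g (k, true)] and [g (k, false)]. *)
Definition arrangements (m : nat) (S : {set 'I_n}) :
    {set {ffun 'I_m * bool -> 'I_n}} :=
  [set g : {ffun 'I_m * bool -> 'I_n} |
     injectiveb g && (g @: [set: 'I_m * bool] == S)].

Definition beats v (i j : 'I_n) : R := v i / (v i + v j).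

(* Outcomes of the matches are encoded by [o], the winner of match [k] being
   [g (k, o k)] and its loser [g (k, ~~ o k)]. *)
Definition losers m (g : {ffun 'I_m * bool -> 'I_n}) (o : {ffun 'I_m -> bool})
  : {set 'I_n} := [set g (k, ~~ o k) | k : 'I_m].

Definition outcome_prob v m (g : {ffun 'I_m * bool -> 'I_n})
    (o : {ffun 'I_m -> bool}) : R :=
  \prod_(k < m) beats v (g (k, o k)) (g (k, ~~ o k)).

(* The probability that a round of [m] matches started with set of alive
   players [A] ends with set of alive players [B]. *)
Definition round_prob v (m : nat) A B : R :=
  uniform_mean (selections m A) (fun S =>
    uniform_mean (arrangements m S) (fun g =>
      \sum_(o : {ffun 'I_m -> bool} | A :\: losers g o == B)
         outcome_prob v g o)).

(* The law of the set of alive players after the rounds [ms]: the Markov chain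
   started at the set of all players with transition kernels [round_prob]. *)
Definition alive_law v (ms : seq nat) : {set 'I_n} -> R :=
  foldl (fun (mu : {set 'I_n} -> R) m B =>
           \sum_(A : {set 'I_n}) mu A * round_prob v m A B)
        (fun A => (A == [set: 'I_n])%:R) ms.

Definition win_prob v (ms : seq nat) (i : 'I_n) : R := alive_law v ms [set i].

End Tournament.

(* Main.v *)
Require Import Defs.
From mathcomp Require Import all_boot all_order all_algebra.
From mathcomp Require Import zify ring lra.
Import Order.TTheory GRing.Theory Num.Theory.
Local Open Scope ring_scope.

(** Every opponent of the weak player [w] beats it with the same probability
    [1 - q], where [q < 1/2]. A round of [m] matches among [r] players picks [w]
    with probability [2m / r], so, whoever else is alive, [w] survives it with
    probability [1 - p m / r], where [p = 2 (1 - q)] lies between 1 and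
    2 ([round_survival]). As the number of survivors of a round is
    deterministic, the winning probability of [w] is the product of these
    factors over the rounds ([win_probE]), and the theorem is about extremal
    values of this product.

    Maximum. Splitting a round of [a + b] matches into a round of [a] and one
    of [b] increases the factor of this round by
    [p (p - 1) a b / (r (r - a)) >= 0] ([split_round]). Splitting until every
    round has a single match gives the best format.

    Minimum. With [n = 2 ^ s + k], the halving format yields
    [(1 - p k / n) (1 - p / 2) ^ s] (its rounds after the first one make
    everybody play). By induction on the format, it suffices that a first
    round of [m] matches followed by halving is no worse for [w] than halving.
    If [m <= k], the new format splits the first round of the halving format,
    and [split_round] applies. If [m > k], the first round jumps below [2 ^ s]
    to [2 ^ (s - 1) + j] players; cancelling the common full rounds
    leaves an inequality between two products of two factors, whose difference
    is again [p (p - 1)] times a nonnegative quantity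
    ([overshoot_round]). *)

(** * One round *)

Lemma uniform_mean_sum {R : realFieldType} {T J : finType} (P : pred J)
    (E : {set T}) (f : J -> T -> R) :
  \sum_(j | P j) uniform_mean E (f j)
    = uniform_mean E (fun x => \sum_(j | P j) f j x).
Proof. by rewrite /uniform_mean -mulr_suml exchange_big. Qed.

Lemma uniform_mean_const {R : realFieldType} {T : finType} (E : {set T})
    (f : T -> R) (c : R) :
  E != set0 -> {in E, forall x, f x = c} -> uniform_mean E f = c.
Proof.
move=> E0 fc; rewrite /uniform_mean (eq_bigr (fun=> c)) // sumr_const.
by rewrite -[c *+ _]mulr_natr mulfK // pnatr_eq0 cards_eq0.
Qed.

(** Averages over arrangements are divided by their number, so a constant is
    recovered only because a set of the right size can be arranged. *)
Lemma arrangements_neq0 {n : nat} (m : nat) (S : {set 'I_n}) :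
  #|S| = (2 * m)%N -> arrangements m S != set0.
Proof.
move=> cS; have cT : #|[set: 'I_m * bool]| = #|S|.
  by rewrite cardsT card_prod card_ord card_bool cS mulnC.
have cT' : #|{: 'I_m * bool}| = #|S| by rewrite -cT cardsT.
pose g := [ffun x : 'I_m * bool => enum_val (cast_ord cT' (enum_rank x))].
have gI : injective g.
  by move=> x y; rewrite !ffunE => /enum_val_inj/cast_ord_inj/enum_rank_inj.
apply/set0Pn; exists g; rewrite inE; apply/andP; split; first exact/injectiveP.
rewrite eqEcard card_imset // cT leqnn andbT.
by apply/subsetP => _ /imsetP[x _ ->]; rewrite ffunE enum_valP.
Qed.

Lemma card_losers {n m : nat} (g : {ffun 'I_m * bool -> 'I_n})
    (o : {ffun 'I_m -> bool}) :
  injective g -> #|losers g o| = m.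
Proof.
by move=> gI; rewrite card_imset ?card_ord // => k l /gI [].
Qed.

Lemma round_prob_card {R : realFieldType} {n : nat} (v : 'I_n -> R) (m : nat)
    (A B : {set 'I_n}) :
  round_prob v m A B != 0 -> #|B| = (#|A| - m)%N.
Proof.
move=> nz; apply/eqP; apply: contraNT nz => cB.
rewrite /round_prob /uniform_mean big1 ?mul0r // => S.
rewrite inE => /andP[SA _]; rewrite big1 ?mul0r // => g.
rewrite inE => /andP[/injectiveP gI /eqP gS]; rewrite big1 // => o /eqP oB.
case/eqP: cB; rewrite -oB cardsD (setIidPr _) ?card_losers //.
apply: subset_trans SA; rewrite -gS.
by apply/subsetP => _ /imsetP[k _ ->]; rewrite imset_f.
Qed.

Lemma round_prob_notin {R : realFieldType} {n : nat} (v : 'I_n -> R) (m : nat)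
    (A B : {set 'I_n}) (w : 'I_n) :
  w \notin A -> w \in B -> round_prob v m A B = 0.
Proof.
move=> wA wB; rewrite /round_prob /uniform_mean big1 ?mul0r // => S _.
rewrite big1 ?mul0r // => g _; rewrite big1 // => o /eqP oB.
by move: wB; rewrite -oB inE (negbTE wA) andbF.
Qed.

(** The matches are independent and [w] survives when none of them has [w] as
    its loser: this restricts the outcome of each match separately, so the sum
    over outcomes factors. *)
Lemma sum_outcomes_survival {R : realFieldType} {n m : nat} (v : 'I_n -> R)
    (g : {ffun 'I_m * bool -> 'I_n}) (w : 'I_n) :
  \sum_(o : {ffun 'I_m -> bool} | w \notin losers g o) outcome_prob v g o
    = \prod_(k < m) \sum_(b | g (k, ~~ b) != w)
        beats v (g (k, b)) (g (k, ~~ b)).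
Proof.
rewrite bigA_distr_big_dep; apply: eq_bigl => o.
apply/idP/familyP => [/imsetP wL k | fam].
  by apply/eqP => wk; apply: wL; exists k.
apply/imsetP => -[k _ wk].
have : g (k, ~~ o k) != w := fam k.
by rewrite -wk eqxx.
Qed.

Lemma beats_total {R : realFieldType} {n : nat} (v : 'I_n -> R) (i j : 'I_n) :
  (forall l, 0 < v l) -> beats v i j + beats v j i = 1.
Proof.
move=> v0; rewrite /beats [v j + v i]addrC -mulrDl divff //.
by rewrite gt_eqF // addr_gt0.
Qed.

Lemma match_total {R : realFieldType} {n m : nat} (v : 'I_n -> R)
    (g : {ffun 'I_m * bool -> 'I_n}) (w : 'I_n) (k : 'I_m) :
  (forall l, 0 < v l) -> (forall b, g (k, b) != w) ->
  \sum_(b | g (k, ~~ b) != w) beats v (g (k, b)) (g (k, ~~ b)) = 1.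
Proof.
move=> v0 gw; rewrite (eq_bigl predT) => [|b]; last by rewrite gw.
by rewrite big_bool /= beats_total.
Qed.

(** All factors of [sum_outcomes_survival] are total probabilities, except that
    of the match of [w], if any, which is reduced to the victory of [w]. *)
Lemma arrangement_survival {R : realFieldType} {n m : nat} (v : 'I_n -> R)
    (w : 'I_n) (q : R) (S : {set 'I_n}) (g : {ffun 'I_m * bool -> 'I_n}) :
  (forall l, 0 < v l) -> (forall j, j != w -> beats v w j = q) ->
  g \in arrangements m S ->
  \sum_(o : {ffun 'I_m -> bool} | w \notin losers g o) outcome_prob v g o
    = if w \in S then q else 1.
Proof.
move=> v0 vq; rewrite inE => /andP[/injectiveP gI /eqP gS].
rewrite sum_outcomes_survival -gS; case: imsetP => [[[k b] _ wE]|nw].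
  have other l c : l != k -> g (l, c) != w.
    by move=> lk; rewrite wE (inj_eq gI) xpair_eqE negb_and lk.
  have opp : g (k, ~~ b) != w.
    by rewrite wE (inj_eq gI) xpair_eqE eqxx; case: (b).
  rewrite (bigD1 k) //= (big_pred1 b) => [|c].
    rewrite -wE vq // big1 ?mulr1 // => l lk.
    by rewrite match_total // => c; apply: other.
  rewrite /= wE (inj_eq gI) xpair_eqE eqxx.
  by case: (b) (c) => [] [].
apply: big1 => k _; rewrite match_total // => b.
by apply/eqP => wE; apply: nw; exists (k, b).
Qed.

(** By [arrangement_survival] the arrangement is irrelevant once the playing set
    is chosen; [w] is left out of it with probability
    ['C(r - 1, 2m) / 'C(r, 2m) = 1 - 2m / r], where [r = #|A|]. *)
Lemma round_survival {R : realFieldType} {n : nat} (v : 'I_n -> R) (w : 'I_n)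
    (q : R) (m : nat) (A : {set 'I_n}) :
  (forall l, 0 < v l) -> (forall j, j != w -> beats v w j = q) ->
  w \in A -> (2 * m <= #|A|)%N ->
  \sum_(B : {set 'I_n} | w \in B) round_prob v m A B
    = 1 - 2 * (1 - q) * m%:R / #|A|%:R.
Proof.
move=> v0 vq wA mA; rewrite uniform_mean_sum.
have selE S : S \in selections m A ->
    \sum_(B : {set 'I_n} | w \in B) uniform_mean (arrangements m S) (fun g =>
        \sum_(o : {ffun 'I_m -> bool} | A :\: losers g o == B)
           outcome_prob v g o)
      = if w \in S then q else 1.
  rewrite inE => /andP[_ /eqP cS]; rewrite uniform_mean_sum.
  apply: uniform_mean_const => [|g gS]; first exact: arrangements_neq0.
  rewrite -(arrangement_survival v w q S g v0 vq gS).
  rewrite [RHS](partition_big (fun o => A :\: losers g o)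
                              (fun B : {set 'I_n} => w \in B)) /=; last first.
    by move=> o wo; rewrite inE wo wA.
  apply: eq_bigr => B wB; apply: eq_bigl => o; rewrite andbC.
  by case: eqP => //= oB; move: wB; rewrite -oB inE wA andbT => ->.
rewrite /uniform_mean (eq_bigr _ selE).
have cA : (0 < #|A|)%N by apply/card_gt0P; exists w.
have cSel : #|selections m A| = 'C(#|A|, 2 * m) by rewrite cards_draws.
have cOut : (\sum_(S in selections m A | w \notin S) 1 = 'C(#|A|.-1, 2 * m))%N.
  (* The selections that leave [w] out are those of [A :\ w]. *)
  have -> : #|A|.-1 = #|A :\ w| by rewrite (cardsD1 w A) wA.
  rewrite -cards_draws -sum1_card; apply: eq_bigl => S.
  by rewrite !inE subsetD1 andbAC.
have ratio := mul_bin_down #|A| (2 * m).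
have -> : \sum_(S in selections m A) (if w \in S then q else 1)
    = q * #|selections m A|%:R + (1 - q) * 'C(#|A|.-1, 2 * m)%:R.
  rewrite -cOut -sum1_card !natr_sum [X in _ + _ * X]big_mkcondr /=.
  rewrite !mulr_sumr -big_split /=; apply: eq_bigr => S _.
  by case: (w \in S) => /=; ring.
have N0 : 'C(#|A|, 2 * m)%:R != 0 :> R by rewrite pnatr_eq0 -lt0n bin_gt0.
have r0 : #|A|%:R != 0 :> R by rewrite pnatr_eq0 -lt0n.
have {}ratio : #|A|%:R * 'C(#|A|.-1, 2 * m)%:R
    = (#|A|%:R - 2 * m%:R) * 'C(#|A|, 2 * m)%:R :> R.
  by rewrite -natrM ratio natrM natrB // natrM.
rewrite cSel.
have -> : 'C(#|A|.-1, 2 * m)%:R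
    = (#|A|%:R - 2 * m%:R) * 'C(#|A|, 2 * m)%:R / #|A|%:R :> R.
  by rewrite -ratio mulrAC mulfV // mul1r.
by field; rewrite N0 r0.
Qed.

(** * The winning probability as a product *)

(** Recursive form of [is_format], with the number [r] of alive players as a
    parameter that decreases along the rounds; this is what inductions on the
    format need. *)
Fixpoint feasible (r : nat) (ms : seq nat) : bool :=
  if ms is m :: ms' then
    [&& (0 < m)%N, (2 * m <= r)%N & feasible (r - m) ms']
  else r == 1%N.

Lemma feasible_cons (r m : nat) (ms : seq nat) :
  feasible r (m :: ms) = [&& (0 < m)%N, (2 * m <= r)%N & feasible (r - m) ms].
Proof. by []. Qed.

Lemma is_format_feasible (n : nat) (ms : seq nat) :
  (2 <= n)%N -> is_format n ms <-> feasible n ms.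
Proof.
move=> n2.
have gen r : (0 < r)%N -> feasible r ms <->
    [/\ all (fun m => (0 < m)%N) ms, sumn ms = (r - 1)%N &
      forall s, (s < size ms)%N ->
        (2 * nth 0%N ms s <= r - sumn (take s ms))%N].
  elim: ms r => [|m ms IH] r r0 /=.
    by split=> [/eqP-> //|[_ rE _]]; apply/eqP; lia.
  split=> [/and3P[m0 mr /IH[|a b c]]|[/andP[m0 a] b c]].
  - by lia.
  - split; [by rewrite m0 | by lia |].
    case=> [|s] /= hs; first by lia.
    by rewrite subnDA; apply: c.
  have := c 0%N isT; rewrite /= subn0 => mr.
  rewrite m0 mr /=; apply/IH; first by lia.
  split=> //; first by lia.
  by move=> s hs; rewrite -subnDA; apply: (c s.+1).
rewrite gen; last by lia.
split=> [[]//|[a b c]]; split=> //.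
by case: ms b {a c gen} => //=; lia.
Qed.

Definition survival {R : realFieldType} (p : R) : nat -> seq nat -> R :=
  fix survival r ms :=
    if ms is m :: ms' then (1 - p * m%:R / r%:R) * survival (r - m)%N ms'
    else 1.

Lemma survival_cons {R : realFieldType} (p : R) (r m : nat) (ms : seq nat) :
  survival p r (m :: ms) = (1 - p * m%:R / r%:R) * survival p (r - m) ms.
Proof. by []. Qed.

(** The rounds do not act on a single set of players but on a distribution on
    such sets. The induction follows the mass that this distribution gives to
    the sets containing [w]: all sets in its support have the same size, so each
    round multiplies the mass by the same factor. *)
Lemma win_probE {R : realFieldType} {n : nat} (v : 'I_n -> R) (w : 'I_n)
    (q : R) (ms : seq nat) :
  (forall l, 0 < v l) -> (forall j, j != w -> beats v w j = q) ->
  feasible n ms -> win_prob v ms w = survival (2 * (1 - q)) n ms.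
Proof.
move=> v0 vq; rewrite /win_prob /alive_law.
set step := fun (mu : {set 'I_n} -> R) m B => _.
have mass r (mu : {set 'I_n} -> R) :
    (forall A, mu A != 0 -> #|A| = r) -> feasible r ms ->
    foldl step mu ms [set w]
      = (\sum_(A : {set 'I_n} | w \in A) mu A) * survival (2 * (1 - q)) r ms.
  elim: ms r mu => [|m ms IH] r mu muC /=.
    move=> /eqP r1; rewrite mulr1 (bigD1 [set w]) ?inE //= big1 ?addr0 // => A.
    case/andP=> wA; apply: contraNeq => /muC; rewrite r1 => /eqP/cards1P[x Ax].
    by move: wA; rewrite Ax inE => /eqP->.
  case/and3P=> m0 mr f; rewrite (IH (r - m)%N) //; last first.
    move=> B; case: (altP (#|B| =P r - m)%N) => // cB.
    rewrite /step big1 ?eqxx // => A _; apply/eqP; rewrite mulf_eq0.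
    apply/norP => -[/muC cA /round_prob_card cB'].
    by move: cB; rewrite cB' cA eqxx.
  rewrite mulrA; congr (_ * _).
  rewrite exchange_big /= mulr_suml [RHS]big_mkcond /=.
  apply: eq_bigr => A _; rewrite -mulr_sumr.
  case: ifPn => [wA|wA]; last first.
    by rewrite big1 ?mulr0 // => B wB; rewrite (round_prob_notin _ _ _ _ w).
  have [->|/muC cA] := eqVneq (mu A) 0; first by rewrite !mul0r.
  by rewrite (round_survival v w q) ?cA.
set mu0 : {set 'I_n} -> R := fun A => _ => f.
rewrite (mass n) //.
  rewrite (bigD1 [set: 'I_n]) ?inE //= big1 ?addr0 /mu0 ?eqxx ?mul1r //.
  by move=> A /andP[_ /negbTE AT]; rewrite AT.
move=> A; rewrite /mu0; have [-> _|_] := eqVneq A setT; last by rewrite eqxx.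
by rewrite cardsT card_ord.
Qed.

(** * Splitting a round, and the best format *)

Lemma split_round {R : realFieldType} (p r a b : R) :
  1 <= p -> 0 <= a -> 0 <= b -> a < r ->
  1 - p * (a + b) / r <= (1 - p * a / r) * (1 - p * b / (r - a)).
Proof.
move=> p1 a0 b0 ar; rewrite -subr_ge0.
have r0 : 0 < r by lra.
have ra : 0 < r - a by lra.
have -> : (1 - p * a / r) * (1 - p * b / (r - a)) - (1 - p * (a + b) / r)
    = p * (p - 1) * (a * b) / (r * (r - a)).
  by field; rewrite !gt_eqF.
by apply: divr_ge0; rewrite !mulr_ge0 //; lra.
Qed.

Lemma round_factor_ge0 {R : realFieldType} (p : R) (m r : nat) :
  0 <= p <= 2 -> (2 * m <= r)%N -> 0 <= 1 - p * m%:R / r%:R.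
Proof.
case/andP=> p0 p2 mr.
have [->|r0] := posnP r; first by rewrite invr0 mulr0 subr0.
rewrite subr_ge0 ler_pdivrMr ?ltr0n // mul1r.
apply: le_trans (_ : 2 * m%:R <= _); first by rewrite ler_wpM2r.
by rewrite -natrM ler_nat.
Qed.

Lemma survival_ge0 {R : realFieldType} (p : R) (r : nat) (ms : seq nat) :
  0 <= p <= 2 -> feasible r ms -> 0 <= survival p r ms.
Proof.
move=> p02; elim: ms r => [|m ms IH] r //= /and3P[_ mr /IH]; apply: mulr_ge0.
exact: round_factor_ge0.
Qed.

Lemma feasible_single (r : nat) : (0 < r)%N -> feasible r (nseq (r - 1) 1%N).
Proof.
by case: r => // r _; rewrite subn1 /=; elim: r.
Qed.

(** Detaching one match at a time from a round of [m] matches improves the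
    chances of [w] at each step, by [split_round] with [a = 1]. *)
Lemma survival_single_round {R : realFieldType} (p : R) (r m : nat) :
  1 <= p <= 2 -> (2 * m <= r)%N -> (0 < r)%N ->
  (1 - p * m%:R / r%:R) * survival p (r - m) (nseq (r - m - 1) 1%N)
    <= survival p r (nseq (r - 1) 1%N).
Proof.
case/andP=> p1 p2; have p02 : 0 <= p <= 2 by lra.
elim: m r => [|m IH] r mr r0; first by rewrite mulr0 mul0r subr0 mul1r subn0.
have -> : (r - 1 = (r - 2).+1)%N by lia.
rewrite [leRHS]/=; have -> : (r - 2 = r - 1 - 1)%N by lia.
have factor0 : 0 <= 1 - p * 1%:R / r%:R by apply: round_factor_ge0 => //; lia.
have {}IH := IH (r - 1)%N ltac:(lia) ltac:(lia).
apply: le_trans (ler_wpM2l factor0 IH).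
have -> : (r - 1 - m = r - m.+1)%N by lia.
rewrite mulrA ler_wpM2r //.
  by apply: survival_ge0 => //; apply: feasible_single; lia.
rewrite natrB; last by lia.
by rewrite -[m.+1]add1n natrD split_round // ?ler0n // ltr1n; lia.
Qed.

Lemma survival_le_single {R : realFieldType} (p : R) (r : nat) (ms : seq nat) :
  1 <= p <= 2 -> feasible r ms ->
  survival p r ms <= survival p r (nseq (r - 1) 1%N).
Proof.
move=> p12; elim: ms r => [|m ms IH] r /=; first by move/eqP->.
case/and3P=> m0 mr /IH le; have p02 : 0 <= p <= 2 by lra.
apply: le_trans (ler_wpM2l (round_factor_ge0 p m r p02 mr) le) _.
by apply: survival_single_round => //; lia.
Qed.

(** * The worst format *)

(** After the first round, the halving format for [2 ^ (s + 1) + k] players is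
    the one for [2 ^ (s + 1) = 2 ^ s + 2 ^ s] players, which is the case
    [k = 2 ^ s] of the next smaller exponent. *)
Lemma halving_formatS (s k : nat) :
  halving_format s.+1 k = k :: halving_format s (2 ^ s)%N.
Proof.
rewrite /halving_format /= subn1 /=; congr [:: _, _ & _].
by rewrite -[1%N]addn0 iotaDl -map_comp; apply: eq_map.
Qed.

Lemma feasible_halving (s k : nat) :
  (0 < k <= 2 ^ s)%N -> feasible (2 ^ s + k) (halving_format s k).
Proof.
elim: s k => [|s IH] k /andP[k0 ks].
  by have -> : k = 1%N by move: ks; rewrite expn0; lia.
rewrite halving_formatS feasible_cons addnK k0 andTb.
apply/andP; split; first by lia.
by rewrite expnS mul2n -addnn IH // expn_gt0 leqnn.
Qed.

Definition halving_survival {R : realFieldType} (p : R) (s k : nat) : R :=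
  (1 - p * k%:R / (2 ^ s + k)%:R) * (1 - p / 2) ^+ s.

Lemma survival_halving {R : realFieldType} (p : R) (s k : nat) :
  survival p (2 ^ s + k) (halving_format s k) = halving_survival p s k.
Proof.
rewrite /halving_survival; elim: s k => [|s IH] k; first by rewrite /= mulr1.
rewrite halving_formatS survival_cons addnK; congr (_ * _).
rewrite {1}expnS mul2n -addnn IH exprS; congr (_ * _).
by rewrite natrD; field; rewrite -natrD pnatr_eq0 addnn double_eq0 expn_eq0.
Qed.

(** Here [a] stands for [2 ^ (s - 1)]: from [2 a + k] players, a round of
    [a + k - j] matches and one of [j] matches lead to [a] players, and this is
    compared with a round of [k] matches followed by a full round. *)
Lemma overshoot_round {R : realFieldType} (p a j k : R) :
  1 <= p -> 0 < a -> 0 <= k -> j <= a -> k <= 2 * j ->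
  (1 - p * k / (2 * a + k)) * (1 - p / 2)
    <= (1 - p * (a + k - j) / (2 * a + k)) * (1 - p * j / (a + j)).
Proof.
move=> p1 a0 k0 ja kj; rewrite -subr_ge0.
have n0 : 0 < 2 * a + k by lra.
have r0 : 0 < a + j by lra.
have -> : (1 - p * (a + k - j) / (2 * a + k)) * (1 - p * j / (a + j))
      - (1 - p * k / (2 * a + k)) * (1 - p / 2)
    = p * (p - 1) * ((a - j) * (2 * j - k)) / (2 * ((2 * a + k) * (a + j))).
  by field; rewrite !gt_eqF.
by apply: divr_ge0; rewrite !mulr_ge0 //; lra.
Qed.

(** The value [k = 0] is allowed: [halving_survival p s 0] is also the value at
    [2 ^ s] players, which keeps the case [m = k], where a power of 2 is
    reached, within the induction, and serves as its base at one player. *)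
Lemma survival_ge_halving {R : realFieldType} (p : R) (s k : nat)
    (ms : seq nat) :
  1 <= p <= 2 -> (k <= 2 ^ s)%N -> feasible (2 ^ s + k) ms ->
  halving_survival p s k <= survival p (2 ^ s + k) ms.
Proof.
case/andP=> p1 p2; have p02 : 0 <= p <= 2 by lra.
rewrite /halving_survival; elim: ms s k => [|m ms IH] s k ks /=.
  move/eqP=> r1; have s0 : (0 < 2 ^ s)%N by rewrite expn_gt0.
  have -> : k = 0%N by lia.
  have -> : s = 0%N by case: s r1 {ks s0} => // s; rewrite expnS; lia.
  by rewrite mulr0 mul0r subr0 mul1r.
case/and3P=> m0 mr f; have factor0 := round_factor_ge0 p m _ p02 mr.
have [mk|km] := leqP m k.
  move: f; rewrite -addnBA // => f.
  apply: le_trans (ler_wpM2l factor0 (IH _ _ _ f)); last by lia.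
  rewrite mulrA ler_wpM2r ?exprn_ge0 //; first by lra.
  have -> : (2 ^ s + (k - m))%:R = (2 ^ s + k)%:R - m%:R :> R.
    by rewrite addnBA // natrB // (leq_trans mk) // leq_addl.
  have -> : k%:R = m%:R + (k - m)%:R :> R by rewrite -natrD subnKC.
  rewrite split_round ?ler0n // ltr_nat.
  by have : (0 < 2 ^ s)%N; [rewrite expn_gt0 | lia].
case: s ks mr f factor0 => [|s]; first by rewrite expn0; lia.
rewrite expnS => ks mr f factor0; pose j := (2 ^ s + k - m)%N.
have rE : (2 * 2 ^ s + k - m = 2 ^ s + j)%N by rewrite /j; lia.
rewrite rE in f *.
apply: le_trans (ler_wpM2l factor0 (IH _ _ _ f)); last by rewrite /j; lia.
rewrite exprS !mulrA ler_wpM2r ?exprn_ge0 //; first by lra.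
have -> : m%:R = (2 ^ s)%:R + k%:R - j%:R :> R.
  by rewrite -natrD -natrB; [congr _%:R; rewrite /j; lia | rewrite /j; lia].
rewrite [(_ * _ + _)%:R]natrD natrM natrD.
rewrite overshoot_round // ?ler0n ?ltr0n ?expn_gt0 //.
  by rewrite ler_nat /j; lia.
by rewrite -natrM ler_nat /j; lia.
Qed.

(* Players 1, ..., n are the elements 0, ..., n - 1 of 'I_n, and [w] is player n *)
Theorem theorem6 (R : realFieldType) (n : nat) (hn : (2 <= n)%N)
    (v : 'I_n -> R) (w : 'I_n) (hw : nat_of_ord w = (n - 1)%N)
    (hv_eq : forall i j : 'I_n, i != w -> j != w -> v i = v j)
    (hv_gt : forall i : 'I_n, i != w -> v w < v i)
    (hv_pos : 0 < v w) :
  (is_format n (single_match_format n) /\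
   forall ms : seq nat, is_format n ms ->
     win_prob v ms w <= win_prob v (single_match_format n) w)
  /\
  (forall s k : nat, (1 <= k <= 2 ^ s)%N -> n = (2 ^ s + k)%N ->
     is_format n (halving_format s k) /\
     forall ms : seq nat, is_format n ms ->
       win_prob v (halving_format s k) w <= win_prob v ms w).
Proof.
have v0 i : 0 < v i.
  by have [->|/hv_gt] := eqVneq i w; [| apply: lt_trans].
have [j0 j0w] : exists j : 'I_n, j != w.
  by exists (Ordinal (ltnW hn)); rewrite -val_eqE /= hw; lia.
pose q := beats v w j0.
have vq j : j != w -> beats v w j = q.
  by move=> jw; rewrite /q /beats (hv_eq j j0).
have p12 : 1 <= 2 * (1 - q) <= 2.
  have q0 : 0 <= q by rewrite divr_ge0 ?addr_ge0 ?ltW.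
  have q1 : 2 * q <= 1.
    rewrite /q /beats mulrA ler_pdivrMr ?addr_gt0 // mul1r.
    by have := hv_gt j0 j0w; lra.
  by lra.
have formatE ms := is_format_feasible n ms hn.
have winE ms : feasible n ms -> win_prob v ms w = survival (2 * (1 - q)) n ms.
  exact: win_probE.
split.
  have f1 : feasible n (single_match_format n) by apply: feasible_single; lia.
  split; first exact/formatE.
  by move=> ms /formatE f; rewrite !winE // survival_le_single.
move=> s k k12 nE; have /andP[_ ks] := k12.
have fh : feasible n (halving_format s k) by rewrite nE feasible_halving.
split; first exact/formatE.
move=> ms /formatE f; rewrite !winE // nE survival_halving.
by apply: survival_ge_halving => //; rewrite -nE.
Qed.
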